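(* Let $(W,I)$ be a Coxeter system and $J\subset I$ a subset such that the parabolic subgroup $W_J$ is finite. Then the poset $\mathcal{Q}^J$ is thin: for any $p<q$ in $\mathcal{Q}^J$ with $\operatorname{rank}(q)-\operatorname{rank}(p)=2$, there are exactly two elements in the open interval $(p,q)$.
   Context: $(W,I)$ is a Coxeter system with simple reflections $s_i$, $i\in I$, length function $\ell$ and Bruhat order $\le$. $W_J=\langle s_j : j\in J\rangle$. $W^J$ (resp. $W^J_{max}$) is the set of minimal (resp. maximal) length coset representatives of $W/W_J$. Let $\mathcal{I}^J\subset W^J_{max}\times W_J\times W^J$ be the set of triples $(x,u,w)$ with $x\le wu$. The poset $\mathcal{Q}^J$ has elements $\{\hat 0\}\cup\{Q_{x,u,w} : (x,u,w)\in\mathcal{I}^J\}$ (distinct triples give distinct elements), with order relation: $Q_{x,u,w}\le Q_{x',u',w'}$ if and only if there exist $u_1,u_2\in W_J$ with $u_1u_2=u$ and $\ell(u)=\ell(u_1)+\ell(u_2)$ such that $x'u'^{-1}\le xu_2^{-1}\le wu_1\le w'$; and $\hat 0<Q_{x,u,w}$ for all $Q_{x,u,w}$. The rank function on $\mathcal{Q}^J$ is $\operatorname{rank}(Q_{x,u,w})=\ell(wu)-\ell(x)$, with $\operatorname{rank}(\hat 0)=-1$ (only rank differences matter). *)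

(* Defs.v *)
From Stdlib Require Import Relation_Operators.
From HB Require Import structures.
From mathcomp Require Import all_boot all_order all_algebra.
From mathcomp Require Import all_classical.

Set Implicit Arguments.
Unset Strict Implicit.
Unset Printing Implicit Defensive.

Local Open Scope classical_set_scope.
Local Open Scope group_scope.

(* The value 0 encodes m_ij = oo; the relation (s_i s_j)^0 = 1 is then void. *)
Definition coxeter_matrix (I : Type) (m : I -> I -> nat) : Prop :=
  [/\ forall i, m i i = 1%N,
      forall i j, m i j = m j i &
      forall i j, i <> j -> m i j <> 1%N].

Definition coxeter_relations (I : Type) (m : I -> I -> nat)
    (G : groupType) (f : I -> G) : Prop :=
  forall i j, (f i * f j) ^+ m i j = 1.

Definition subgroup_gen (G : groupType) (A : set G) : set G :=
  smallest [set H : set G | group_closed (mem H)] A.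

(* W is the group presented by the Coxeter relations of some Coxeter matrix:
   it satisfies them, is generated by the s_i, and is universal as such. *)
Definition coxeter_system (W : groupType) (I : Type) (s : I -> W) : Prop :=
  exists m : I -> I -> nat,
    [/\ coxeter_matrix m,
        coxeter_relations m s,
        subgroup_gen (range s) = setT &
        forall (G : groupType) (f : I -> G), coxeter_relations m f ->
          exists phi : {multiplicative W -> G}, forall i, phi (s i) = f i].

Section CoxeterGroup.
Variables (W : groupType) (I : Type) (s : I -> W).
Implicit Types (x y u w : W) (J : set I).

(* The default value 0 is only reached off the monoid generated by the s_i,
   which is all of W when (W, I) is a Coxeter system. *)
Definition length w : nat :=
  xget 0%N [set n | (exists2 r : seq I, size r = n & w = \prod_(i <- r) s i) /\
                    (forall r : seq I, w = \prod_(i <- r) s i -> n <= size r)].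

Definition reflection : set W := [set s i ^ w | i in setT & w in setT].

Definition bruhat_step x y : Prop :=
  exists2 t, reflection t & y = x * t /\ length x < length y.

Definition bruhat : W -> W -> Prop := clos_refl_trans W bruhat_step.

Definition parabolic J : set W := subgroup_gen (s @` J).

(* Representatives of the left cosets w W_J. *)
Definition min_reps J : set W :=
  [set w | forall v, parabolic J v -> length w <= length (w * v)].

Definition max_reps J : set W :=
  [set x | forall v, parabolic J v -> length (x * v) <= length x].

Definition triples J : set (W * W * W) :=
  [set t | let: (x, u, w) := t in
    [/\ max_reps J x, parabolic J u, min_reps J w & bruhat x (w * u)]].

Inductive Q J : Type :=
  | Qhat0
  | Qcell of triples J.

Definition Qle J (p q : Q J) : Prop :=
  match p, q with
  | Qhat0, _ => True
  | Qcell _, Qhat0 => False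
  | Qcell a, Qcell b =>
      let: (x, u, w) := val a in
      let: (x', u', w') := val b in
      exists u1 u2,
        [/\ parabolic J u1, parabolic J u2, u1 * u2 = u &
            length u = (length u1 + length u2)%N] /\
        [/\ bruhat (x' * u'^-1) (x * u2^-1),
            bruhat (x * u2^-1) (w * u1) &
            bruhat (w * u1) w']
  end.

Definition Qlt J (p q : Q J) : Prop := Qle p q /\ p <> q.

Definition Qrank J (p : Q J) : int :=
  match p with
  | Qhat0 => (-1)%R
  | Qcell a => let: (x, u, w) := val a in
      ((length (w * u))%:Z - (length x)%:Z)%R
  end.

End CoxeterGroup.

(* Main.v *)
(* Writing v = x u^-1, the cells become the pairs (v, w) with v <= w and w in
   W^J, and Q_{v,w} <= Q_{v',w'} holds iff v' <= v z and w z <= w' for some z in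
   W_J with l(v z) = l(v) + l(z).  This relation makes sense on all of W x W^J,
   where the pairs with v <= w form an upper set, so v <= w can be ignored when
   looking inside an interval.  On W x W^J a simple reflection s acts on the
   left of the second component: (v, w) goes to (v, s w), except that s w = w s_j
   with j in J is absorbed into the first component as (v s_j, w).  This action
   is an involution changing the rank by one, and it satisfies the same lifting
   property as multiplication by a simple reflection in the Bruhat order.
   Thinness follows from lifting by induction: a left descent of w' moves the
   interval down until w' = 1, where it is an interval of the (reversed) Bruhat
   order, which is thin by the same argument.  The interval below a cell of rank
   one is computed directly.  The Coxeter-theoretic input all comes from the
   inversion cocycle, obtained by extending s_i |-> (s_i, [t = s_i]) to a
   morphism from W to a semidirect product of W with the boolean functions
   on W. *)

Require Import Defs.
From HB Require Import structures.
From Stdlib Require Import Relation_Operators Operators_Properties.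
From mathcomp Require Import all_boot all_order all_algebra.
From mathcomp Require Import all_classical.
From mathcomp Require Import zify.

Set Implicit Arguments.
Unset Strict Implicit.
Unset Printing Implicit Defensive.

Local Open Scope classical_set_scope.
Local Open Scope card_scope.
Local Open Scope group_scope.

(** * The inversion cocycle *)

(** A synonym of the product type, so that it can carry a semidirect product law. The functions
    record parities, and W acts on them by conjugating the argument. *)
Definition twisted (W : groupType) : Type := (W * (W -> bool))%type.

HB.instance Definition _ (W : groupType) := gen_eqMixin (twisted W).
HB.instance Definition _ (W : groupType) := gen_choiceMixin (twisted W).

Section Twisted.
Variable W : groupType.
Implicit Types a b c : twisted W.

Definition tw_mul a b : twisted W :=
  (a.1 * b.1, fun t => b.2 t (+) a.2 (t ^ b.1^-1)).
Definition tw_one : twisted W := (1, fun=> false).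
Definition tw_inv a : twisted W := (a.1^-1, fun t => a.2 (t ^ a.1)).

Lemma tw_mulA : associative tw_mul.
Proof.
move=> a b c; rewrite /tw_mul /= mulgA; congr pair; apply/funext => t /=.
by rewrite addbA invgM conjgM.
Qed.

Lemma tw_mul1 : left_id tw_one tw_mul.
Proof.
move=> [a f]; rewrite /tw_mul /= mul1g; congr pair.
by apply/funext => t; rewrite addbF.
Qed.

Lemma tw_mulr1 : right_id tw_one tw_mul.
Proof.
move=> [a f]; rewrite /tw_mul /= mulg1; congr pair.
by apply/funext => t; rewrite invg1 conjg1.
Qed.

Lemma tw_mulV : left_inverse tw_one tw_inv tw_mul.
Proof.
move=> [a f]; rewrite /tw_mul /tw_one /= mulVg; congr pair.
by apply/funext => t; rewrite conjgKV addbb.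
Qed.

Lemma tw_mulrV : right_inverse tw_one tw_inv tw_mul.
Proof.
move=> [a f]; rewrite /tw_mul /tw_one /= mulgV; congr pair.
by apply/funext => t; rewrite invgK addbb.
Qed.

HB.instance Definition _ := isGroup.Build (twisted W)
  tw_mulA tw_mul1 tw_mulr1 tw_mulV tw_mulrV.

Lemma tw_mulE a b : a * b = (a.1 * b.1, fun t => b.2 t (+) a.2 (t ^ b.1^-1)).
Proof. by []. Qed.

Lemma tw_expE a n : a ^+ n =
  (a.1 ^+ n, fun t => \big[addb/false]_(k < n) a.2 (t ^ a.1 ^- k)).
Proof.
elim: n => [|n IH].
  by rewrite !expg0; congr pair; apply/funext => t; rewrite big_ord0.
rewrite expgSr IH tw_mulE /= -expgSr; congr pair; apply/funext => t.
rewrite big_ord_recl /= expg0 invg1 conjg1; congr addb.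
apply: eq_bigr => k _; rewrite -conjgM -invgM -expgSr.
by [].
Qed.

End Twisted.

Section Cocycle.
Variables (W : groupType) (I : Type) (s : I -> W).
Hypothesis cox : coxeter_system s.

Lemma simple_sq i : s i * s i = 1.
Proof.
by have [m [[m1 _ _] rel _ _]] := cox; have := rel i i; rewrite m1 expg1.
Qed.

Definition tw_simple (i : I) : twisted W := (s i, fun t => t == s i).

(** The sum runs over two full periods, which cancel modulo 2. *)
Lemma big_addb_periodic (g : nat -> bool) m : (forall n, g (n + m)%N = g n) ->
  \big[addb/false]_(k < m) (g k.*2 (+) g k.*2.+1) = false.
Proof.
move=> per.
have -> : \big[addb/false]_(k < m) (g k.*2 (+) g k.*2.+1) =
          \big[addb/false]_(0 <= n < m + m) g n.
  rewrite addnn; elim: (m) => [|n IH]; first by rewrite big_ord0 big_geq.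
  by rewrite big_ord_recr /= IH doubleS !big_nat_recr //= addbA.
rewrite (@big_cat_nat _ _ _ m) //= ?leq_addr //.
rewrite -{2}[m]add0n big_addn addnK.
under [X in _ (+) X]eq_bigr do rewrite per.
by rewrite addbb.
Qed.

(** With a = s_i s_j and N = [m i j], the second component of the N-th power at t is the sum of
    [t = a^-n s_j] over 0 <= n < 2N. Since a^N = 1, the terms have period N in n and cancel. *)
Lemma tw_relations m : coxeter_relations m s -> coxeter_relations m tw_simple.
Proof.
move=> rel i j; rewrite tw_mulE tw_expE /=; congr pair; first exact: rel.
apply/funext => t; set a := s i * s j; set n := m i j.
have an : a ^+ n = 1 by exact: rel.
have sV k : (s k)^-1 = s k by apply: mulg1_eq; apply: simple_sq.
have asj : a ^ s j = a^-1.
  by rewrite /a conjgE invgM !sV -!mulgA simple_sq mulg1.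
have aksj k : (s j) ^ (a ^+ k) = a ^- k.*2 * s j.
  rewrite conjgE -addnn expgnDr invgM -mulgA; congr (_ * _).
  by rewrite [RHS]conjgC conjVg conjXg asj expVgn invgK.
have E (k : nat) : (t ^ a ^- k == s j) = (t == a ^- k.*2 * s j).
  by rewrite -aksj -[LHS](inj_eq (@conjg_inj W (a ^+ k))) /= conjgKV.
have E2 (k : nat) : ((t ^ a ^- k) ^ (s j)^-1 == s i) = (t == a ^- k.*2.+1 * s j).
  rewrite -[LHS](inj_eq (@conjg_inj W (s j))) /= conjgKV.
  have -> : s i ^ s j = a^-1 * s j.
    by rewrite conjgE invgM !sV -!mulgA.
  rewrite -[LHS](inj_eq (@conjg_inj W (a ^+ k))) /= conjgKV conjMg aksj.
  have -> : a^-1 ^ (a ^+ k) = a^-1.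
    rewrite conjVg; congr (_^-1); rewrite conjgE -expgS expgSr mulKg //.
  by rewrite mulgA -invgM -expgSr.
under eq_bigr do rewrite E E2.
rewrite (@big_addb_periodic (fun k => t == a ^- k * s j)) // => k.
by rewrite expgnDr an mulg1.
Qed.

Lemma gen_ind (A : set W) (P : W -> Prop) : P 1 ->
  (forall x y, P x -> P y -> P (x * y^-1)) -> (forall a, A a -> P a) ->
  forall w, subgroup_gen A w -> P w.
Proof.
move=> P1 PF PA w; apply => /=; split => //.
split; first by rewrite inE.
by move=> x y; rewrite !inE; apply: PF.
Qed.

Lemma inversion_cocycle : exists eta : W -> W -> bool,
  (forall a b t, eta (a * b) t = eta b t (+) eta a (t ^ b^-1)) /\
  (forall i t, eta (s i) t = (t == s i)).
Proof.
have [m [_ rel gen univ]] := cox.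
have [phi phiS] := univ _ _ (tw_relations rel).
have phi1 : phi 1 = 1 by apply: (@mulgI _ (phi 1)); rewrite -gmulfM !mulg1.
have phiV y : phi y^-1 = (phi y)^-1.
  by apply/esym/mulg1_eq; rewrite -gmulfM mulgV.
(* The first component of [phi] is multiplicative and fixes the generators, so it is the
   identity. *)
have fst_phi w : (phi w).1 = w.
  have : subgroup_gen (range s) w by rewrite gen.
  move: w; apply: gen_ind => [|x y hx hy|_ [i _ <-]].
  - by rewrite phi1.
  - by rewrite gmulfM phiV /= hx hy.
  - by rewrite phiS.
exists (fun w => (phi w).2); split => [a b t|i t]; last by rewrite phiS.
by rewrite gmulfM tw_mulE /= fst_phi.
Qed.

End Cocycle.

(** * Lifting involutions and thinness *)

(** An axiomatic form of multiplication by a simple reflection in the Bruhat order, with [rk] in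
    place of the length. It is instantiated for the Bruhat order and for the order on pairs. *)
Record lifting (T : Type) (D : T -> Prop) (le : T -> T -> Prop) (rk : T -> int)
    (f : T -> T) : Prop := Lifting {
  lift_dom : forall p, D p -> D (f p);
  liftK : forall p, D p -> f (f p) = p;
  lift_rank : forall p, D p -> (rk (f p) = rk p + 1 \/ rk (f p) = rk p - 1)%R;
  lift_le : forall p, D p -> (rk p < rk (f p))%R -> le p (f p);
  lift_updown : forall p q, le p q -> (rk p < rk (f p))%R ->
    (rk (f q) < rk q)%R -> le (f p) q /\ le p (f q);
  lift_upup : forall p q, le p q -> (rk p < rk (f p))%R ->
    (rk q < rk (f q))%R -> le (f p) (f q);
  lift_downdown : forall p q, le p q -> (rk (f p) < rk p)%R ->
    (rk (f q) < rk q)%R -> le (f p) (f q) }.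

Lemma card_pair (T : Type) (a b : T) : a <> b -> [set a; b] #= `I_2.
Proof.
move=> ab; apply/pcard_eqP.
suff /Pbij[f] : set_bij [set a; b] `I_2 (fun x => (~~ `[< x = a >] : nat)).
  by squash f.
have aa : `[< a = a >] by apply/asboolP.
have ba : `[< b = a >] = false by apply/asboolP => /esym.
split=> [x [] ->|x y|[|[|//]] _] /=; rewrite ?aa ?ba //.
- by rewrite !inE => -[] -> [] ->; rewrite ?aa ?ba.
- by exists a; [left|rewrite aa].
- by exists b; [right|rewrite ba].
Qed.

Section Thinness.
Variables (T : Type) (D : T -> Prop) (le : T -> T -> Prop) (rk : T -> int).
Hypothesis le_dom : forall p q, le p q -> D p /\ D q.
Hypothesis le_eq : forall p q, le p q -> rk p = rk q -> p = q.

Definition between p q r := [/\ le p r, le r q & (rk r = rk p + 1)%R].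

Definition diamond p q :=
  exists a b, a <> b /\ forall r, between p q r <-> r = a \/ r = b.

(** If [f] moves p up, lifting makes [f p] and [f q] the middle elements: a middle r moved up by [f]
    equals [f q], and one moved down equals [f p]. If [f] moves p down, the middle of (p, q) is in
    bijection with that of (f p, f q). *)
Lemma diamond_lift f p q : lifting D le rk f ->
  le p q -> (rk q = rk p + 2)%R -> (rk (f q) < rk q)%R ->
  ((rk (f p) < rk p)%R -> diamond (f p) (f q)) -> diamond p q.
Proof.
move=> L lepq rkpq qdown IH.
have [Dp Dq] := le_dom lepq.
have fqq : le (f q) q.
  rewrite -{2}(liftK L Dq); apply: (lift_le L (lift_dom L Dq)).
  by rewrite (liftK L Dq).
have rq := lift_rank L Dq; have rp := lift_rank L Dp.
case: (boolP (rk p < rk (f p))%R) => [pup|pnup].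
  have [fpq pfq] := lift_updown L lepq pup qdown.
  exists (f p), (f q); split => [E|r].
    have := congr1 f E; rewrite (liftK L Dp) (liftK L Dq) => E'.
    by rewrite E' in rkpq; lia.
  split=> [[pr rq' rkr]|[] ->]; last 2 first.
  - by split => //; [apply: lift_le L _ Dp pup|lia].
  - by split => //; lia.
  have [_ Dr] := le_dom pr; have rr := lift_rank L Dr.
  case: (boolP (rk r < rk (f r))%R) => [rup|rnup]; [right|left].
    have [_ rfq] := lift_updown L rq' rup qdown.
    by apply: (le_eq rfq); lia.
  have rdown : (rk (f r) < rk r)%R by lia.
  have [fpr _] := lift_updown L pr pup rdown.
  by apply/esym/(le_eq fpr); lia.
have pdown : (rk (f p) < rk p)%R by lia.
have [a [b [ab abP]]] := IH pdown.
have fpfq := lift_downdown L lepq pdown qdown.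
have [Dfp Dfq] := le_dom fpfq.
have fpp : le (f p) p.
  by rewrite -{2}(liftK L Dp); apply: (lift_le L Dfp); rewrite (liftK L Dp).
have fpup : (rk (f p) < rk (f (f p)))%R by rewrite (liftK L Dp).
have fqup : (rk (f q) < rk (f (f q)))%R by rewrite (liftK L Dq).
have Dmid z : between (f p) (f q) z -> D z by case=> /le_dom[].
have mid_down z : between (f p) (f q) z -> ~~ (rk z < rk (f z))%R -> z = p.
  move=> zM znup; have rz := lift_rank L (Dmid _ zM); case: zM => fpz zfq rkz.
  have zdown : (rk (f z) < rk z)%R by lia.
  have [+ _] := lift_updown L fpz fpup zdown.
  by rewrite (liftK L Dp) => pz; apply/esym/(le_eq pz); lia.
(* The bijection is [f] itself on elements moved up. The only middle element of (f p, f q) that can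
   move down is p, and it is sent to [f q]. *)
pose g z := if (rk z < rk (f z))%R then f z else f q.
have gM z : between (f p) (f q) z -> between p q (g z).
  move=> zM; rewrite /g; have rz := lift_rank L (Dmid _ zM).
  case: ifPn => [zup|/(mid_down _ zM) zp].
    case: zM => fpz zfq rkz; split; last by lia.
      by rewrite -(liftK L Dp); apply: (lift_upup L).
    by rewrite -(liftK L Dq); apply: (lift_upup L).
  by rewrite zp in zM; case: zM => _ pfq _; split=> //; lia.
have Mg r : between p q r -> exists2 z, between (f p) (f q) z & r = g z.
  move=> [pr rleq rkr]; have [_ Dr] := le_dom pr; have rr := lift_rank L Dr.
  case: (boolP (rk r < rk (f r))%R) => [rup|rnup].
    have [_ rfq] := lift_updown L rleq rup qdown.
    have rE : r = f q by apply: (le_eq rfq); lia.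
    exists p; last by rewrite /g (negPf pnup).
    by split => //; [rewrite -rE|lia].
  exists (f r); last by rewrite /g (liftK L Dr); case: ifPn => //; lia.
  have rdown : (rk (f r) < rk r)%R by lia.
  by split; [apply: (lift_downdown L)|apply: (lift_downdown L)|lia].
have g_inj y z : between (f p) (f q) y -> between (f p) (f q) z ->
    g y = g z -> y = z.
  move=> yM zM; rewrite /g.
  have neq x : between (f p) (f q) x -> f x = f q -> False.
    move=> xM E; have := congr1 f E; rewrite (liftK L (Dmid _ xM)) (liftK L Dq).
    by move=> xq; case: xM; rewrite xq; lia.
  case: ifPn => [yup|/(mid_down _ yM) ->]; case: ifPn => [zup|/(mid_down _ zM) ->].
  - by move/(congr1 f); rewrite !(liftK L (Dmid _ _)).
  - by move/neq => /(_ yM).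
  - by move/esym/neq => /(_ zM).
  - by [].
have aM : between (f p) (f q) a by apply/abP; left.
have bM : between (f p) (f q) b by apply/abP; right.
exists (g a), (g b); split => [E|r]; first by apply: ab; apply: g_inj E.
by split => [/Mg[z /abP[]-> ->]|[] ->]; [left|right|exact: gM|exact: gM].
Qed.

End Thinness.

(** * Length, exchange and Bruhat order *)

Section CoxeterCombinatorics.
Variables (W : groupType) (I : Type) (s : I -> W).
Hypothesis cox : coxeter_system s.

Local Notation len := (length s).
Definition word (r : seq I) : W := \prod_(i <- r) s i.

Lemma word_nil : word [::] = 1. Proof. exact: big_nil. Qed.

Lemma word_cons i r : word (i :: r) = s i * word r.
Proof. exact: big_cons. Qed.

Lemma word_cat r q : word (r ++ q) = word r * word q.
Proof. exact: big_cat. Qed.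

Lemma word1 i : word [:: i] = s i. Proof. exact: big_seq1. Qed.

Local Notation "x <=B y" := (bruhat s x y) (at level 70).

(* [mulgA] itself leaves behind instance paths that [lia] does not identify. *)
Let mulA (x y z : W) : x * (y * z) = x * y * z. Proof. exact: mulgA. Qed.

Let simpleK i x : x * s i * s i = x.
Proof. by rewrite -mulA simple_sq // mulg1. Qed.

Let simpleKl i x : s i * (s i * x) = x.
Proof. by rewrite mulA simple_sq // mul1g. Qed.

Let simpleV i : (s i)^-1 = s i.
Proof. by apply/mulg1_eq/simple_sq. Qed.

Lemma wordV r : (word r)^-1 = word (rev r).
Proof.
elim: r => [|i r IH]; first by rewrite !word_nil invg1.
by rewrite rev_cons -cats1 word_cat word1 word_cons invgM IH simpleV.
Qed.

Local Notation wordof A r := (all (fun i => `[< A%classic i >]) r).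

Lemma gen_word (A : set I) w : parabolic s A w ->
  exists2 r : seq I, wordof A r & w = word r.
Proof.
move: w; apply: gen_ind => [|x y [r1 A1 ->] [r2 A2 ->]|_ [i Ai <-]].
- by exists [::] => //; rewrite word_nil.
- by exists (r1 ++ rev r2); rewrite ?all_cat ?all_rev ?A1 // word_cat wordV.
- by exists [:: i]; rewrite ?word1 //= andbT; apply/asboolP.
Qed.

Lemma parabolic1 A : parabolic s A 1.
Proof. by move=> H [[+ _] _]; rewrite inE. Qed.

Lemma parabolicF A x y : parabolic s A x -> parabolic s A y ->
  parabolic s A (x * y^-1).
Proof.
move=> Px Py H HA; have [[_ HF] _] := HA.
by have := HF x y; rewrite !inE; apply; [apply: Px|apply: Py].
Qed.

Lemma parabolicV A x : parabolic s A x -> parabolic s A x^-1.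
Proof.
by move=> Px; rewrite -[x^-1]mul1g; apply: parabolicF => //; apply: parabolic1.
Qed.

Lemma parabolicM A x y : parabolic s A x -> parabolic s A y ->
  parabolic s A (x * y).
Proof. by move=> Px /parabolicV; rewrite -{2}[y]invgK; apply: parabolicF. Qed.

Lemma parabolic_simple (A : set I) i : A i -> parabolic s A (s i).
Proof. by move=> Ai H [_]; apply; exists i. Qed.

Lemma word_surj w : exists r : seq I, w = word r.
Proof.
have [_ [_ _ gen _]] := cox.
have [] : exists2 r : seq I, wordof setT r & w = word r.
  by apply: gen_word; rewrite /parabolic gen.
by move=> r; exists r.
Qed.

(** Every element is a product of simple reflections, so the default value in [length] is never
    taken. *)
Lemma length_spec w : (exists2 r : seq I, size r = len w & w = word r) /\
  (forall r : seq I, w = word r -> len w <= size r)%N.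
Proof.
pose P n := `[< exists2 r : seq I, size r = n & w = word r >].
have exP : exists n, P n.
  by have [r wr] := word_surj w; exists (size r); apply/asboolP; exists r.
rewrite /length; case: xgetP => [n -> //|/(_ (ex_minn exP))[]].
case: ex_minnP => n /asboolP ? min_n; split => // r wr.
by apply: min_n; apply/asboolP; exists r.
Qed.

Lemma reduced_word w : exists2 r : seq I, size r = len w & w = word r.
Proof. by have [] := length_spec w. Qed.

Lemma length_word (r : seq I) : (len (word r) <= size r)%N.
Proof. by have [_] := length_spec (word r); apply. Qed.

Lemma length1 : len 1 = 0%N.
Proof. by have := length_word [::]; rewrite word_nil; case: len. Qed.

Lemma length_eq0 w : len w = 0%N -> w = 1.
Proof. by have [[|i r] <- ->] := reduced_word w; rewrite ?word_nil. Qed.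

Lemma lengthV w : len w^-1 = len w.
Proof.
suff le x : (len x^-1 <= len x)%N.
  by apply/eqP; rewrite eqn_leq le -{1}[w]invgK le.
have [r <- ->] := reduced_word x; rewrite wordV -(size_rev r).
exact: length_word.
Qed.

Lemma lengthM x y : (len (x * y) <= len x + len y)%N.
Proof.
have [r <- ->] := reduced_word x; have [q <- ->] := reduced_word y.
by rewrite -word_cat -size_cat; apply: length_word.
Qed.

Lemma length_simple_le i : (len (s i) <= 1)%N.
Proof. by have := length_word [:: i]; rewrite word1. Qed.

(* For a reflection [t], [eta w t] says that [t] is a right inversion of [w]
   ([etaE]); the cocycle rule [etaM] holds for every [t]. *)
Definition eta : W -> W -> bool := projT1 (cid (inversion_cocycle cox)).

Lemma etaM a b t : eta (a * b) t = eta b t (+) eta a (t ^ b^-1).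
Proof. by rewrite /eta; case: cid => e /= []. Qed.

Lemma eta_simple i t : eta (s i) t = (t == s i).
Proof. by rewrite /eta; case: cid => e /= []. Qed.

Lemma eta1 t : eta 1 t = false.
Proof. by have := etaM 1 1 t; rewrite mul1g invg1 conjg1 addbb. Qed.

(** The strong exchange property. By the cocycle rule, [eta] counts modulo 2 the letters of the word
    whose conjugate by the letters to their right is t; an odd count provides such a letter, and
    multiplying by t deletes it. *)
Lemma eta_exchange r t : eta (word r) t ->
  exists r1 i r2, r = r1 ++ i :: r2 /\ word r * t = word (r1 ++ r2).
Proof.
elim: r => [|i r IH]; first by rewrite word_nil eta1.
rewrite word_cons etaM eta_simple.
case: (boolP (eta (word r) t)) => [/IH[r1 [j [r2 [-> E]]]] _|_ /= /eqP E].
  exists (i :: r1), j, r2; split => //.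
  by rewrite cat_cons word_cons -mulA E.
exists [::], i, r; split => //=.
by rewrite -mulA (conjgCV _ t) E simpleKl.
Qed.

Lemma eta_length w t : eta w t -> (len (w * t) < len w)%N.
Proof.
have [r <- ->] := reduced_word w => /eta_exchange[r1 [i [r2 [-> ->]]]].
by apply: leq_ltn_trans (length_word _) _; rewrite !size_cat /= addnS.
Qed.

Lemma reflectionJ t x : reflection s t -> reflection s (t ^ x).
Proof.
by move=> [i _ [y _ <-]]; exists i => //; exists (y * x) => //; rewrite conjgM.
Qed.

Lemma reflection_simple i : reflection s (s i).
Proof. by exists i => //; exists 1 => //; rewrite conjg1. Qed.

Lemma reflectionK t x : reflection s t -> x * t * t = x.
Proof.
move=> [i _ [y _ <-]].
by rewrite -mulA -conjMg simple_sq // conj1g mulg1.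
Qed.

(** Expanding t = u^-1 s_i u by the cocycle rule, the contributions of u and u^-1 cancel because
    [eta] vanishes at u^-1 u. What remains is [eta (s i) (s i)]. *)
Lemma eta_reflection t : reflection s t -> eta t t.
Proof.
move=> [i _ [u _ <-]].
have := etaM u^-1 u (s i ^ u); rewrite mulVg eta1 conjgK.
have -> : eta (s i ^ u) (s i ^ u) =
    eta u (s i ^ u) (+) (true (+) eta u^-1 (s i)).
  have sJ : s i ^ (s i)^-1 = s i by rewrite conjgE invgK mulgV mulg1.
  by rewrite {1}conjgE !etaM invgM conjgM !conjgK sJ eta_simple eqxx -addbA.
by case: (eta u _); case: (eta _ (s i)).
Qed.

Lemma etaE w t : reflection s t -> eta w t = (len (w * t) < len w)%N.
Proof.
move=> rt; case: (boolP (eta w t)) => [/eta_length-> //|wt].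
have : eta (w * t) t.
  rewrite etaM (eta_reflection rt).
  by rewrite conjgE invgK mulgV mulg1 (negPf wt).
move/eta_length; rewrite reflectionK // => lt.
by apply/esym/negbTE; rewrite -leqNgt ltnW.
Qed.

Lemma length_reflection w t : reflection s t -> eta w t = false ->
  (len w < len (w * t))%N.
Proof.
move=> rt wt; have : eta (w * t) t.
  rewrite etaM (eta_reflection rt).
  by rewrite conjgE invgK mulgV mulg1 wt.
by move/eta_length; rewrite reflectionK.
Qed.

Lemma length_simple w i :
  len (w * s i) = if eta w (s i) then (len w).-1 else (len w).+1.
Proof.
have le x : (len (x * s i) <= (len x).+1)%N.
  by have := lengthM x (s i); have := length_simple_le i; lia.
have := le (w * s i); rewrite simpleK; have := le w.
case: ifP => [/eta_length|/(length_reflection (reflection_simple i))]; lia.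
Qed.

Lemma eta_simple_gt0 w i : eta w (s i) -> (0 < len w)%N.
Proof. by move/eta_length; case: (len w). Qed.

Lemma right_descent w : w <> 1 -> exists i, eta w (s i).
Proof.
have [r sr wr] := reduced_word w; rewrite wr in sr *.
case: (lastP r) sr => [|r' i]; first by rewrite word_nil.
rewrite -cats1 size_cat word_cat word1 /= addn1 => sr _; exists i.
rewrite etaE; last exact: reflection_simple.
by rewrite simpleK -sr ltnS; apply: length_word.
Qed.

Lemma length_simpleP w i :
  len (w * s i) = (len w).+1 \/ len w = (len (w * s i)).+1.
Proof.
rewrite length_simple; case: ifP => [/eta_simple_gt0|]; [right|left] => //.
by rewrite prednK.
Qed.

Lemma length_simplelE w i : len (s i * w) = len (w^-1 * s i).
Proof. by rewrite -lengthV invgM simpleV. Qed.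

Lemma length_simplelP w i :
  len (s i * w) = (len w).+1 \/ len w = (len (s i * w)).+1.
Proof. by rewrite length_simplelE -(lengthV w); apply: length_simpleP. Qed.

Lemma eta_up w i : (len w < len (w * s i))%N -> eta w (s i) = false.
Proof. by rewrite length_simple; case: eta; lia. Qed.

Lemma bruhat_refl x : x <=B x. Proof. exact: rt_refl. Qed.

Lemma bruhat_trans y x z : x <=B y -> y <=B z -> x <=B z.
Proof. exact: rt_trans. Qed.

Lemma bruhat_length x y : x <=B y -> (len x <= len y)%N.
Proof.
by elim=> [a b [t _ [_ /ltnW]]|a|a b c _ ab _ bc] //; apply: leq_trans ab bc.
Qed.

Lemma bruhat_eq x y : x <=B y -> len x = len y -> x = y.
Proof.
elim=> [a b [t _ [_ lt]] E|//|a b c ab IHab bc IHbc E]; first by rewrite E ltnn in lt.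
have := bruhat_length ab; have := bruhat_length bc => lbc lab.
have /andP[/eqP/IHab-> /eqP/IHbc->] // : (len a == len b) && (len b == len c).
by clear -E lbc lab; lia.
Qed.

Lemma bruhat_simple x i : (len x < len (x * s i))%N -> x <=B x * s i.
Proof. by move=> lt; apply: rt_step; exists (s i) => //; apply: reflection_simple. Qed.

Lemma bruhat_simplel x i : (len x < len (s i * x))%N -> x <=B s i * x.
Proof.
move=> lt; apply: rt_step; exists (s i ^ x); first by exists i => //; exists x.
by rewrite conjgE mulVKg.
Qed.

(** Multiplying by s_i conjugates the inversions and toggles only s_i itself, so the length
    comparison survives unless t = s_i. *)
Lemma bruhat_step_simple i x y : bruhat_step s x y ->
  y = x * s i \/ bruhat_step s (x * s i) (y * s i).
Proof.
move=> [t rt [-> lt]]; case: (t =P s i) => [->|tsi]; [by left|right].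
have E : x * t * s i = x * s i * (t ^ s i).
  by rewrite conjgE simpleV !mulA simpleK.
exists (t ^ s i); first exact: reflectionJ.
split=> //; rewrite E; apply: length_reflection; first exact: reflectionJ.
rewrite etaM conjgK (etaE _ rt) [(_ < len x)%N]ltnNge (ltnW lt) addbF eta_simple.
apply/eqP => /(congr1 (fun z => z ^ (s i)^-1)); rewrite conjgK => tE.
by apply: tsi; rewrite tE conjgE invgK mulgV mulg1.
Qed.

Lemma bruhat_step_simplel i x y : bruhat_step s x y ->
  y = s i * x \/ bruhat_step s (s i * x) (s i * y).
Proof.
move=> [t rt [-> lt]]; case: (t ^ x^-1 =P s i) => [tsi|tsi]; [left|right].
  by rewrite -tsi -conjgCV.
exists t => //; rewrite mulA; split=> //; apply: length_reflection => //.
rewrite etaM (etaE _ rt) [(_ < len x)%N]ltnNge (ltnW lt) eta_simple.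
by case: eqP tsi.
Qed.

(** * The lifting property, for left and right multiplication at once *)

Section Lift.
Variable f : W -> W.
Hypothesis fK : involutive f.
Hypothesis f_len : forall x, len (f x) = (len x).+1 \/ len x = (len (f x)).+1.
Hypothesis f_le : forall x, (len x < len (f x))%N -> x <=B f x.
Hypothesis f_step : forall x y, bruhat_step s x y ->
  y = f x \/ bruhat_step s (f x) (f y).

Let f_ge x : (len (f x) < len x)%N -> f x <=B x.
Proof. by move=> lt; rewrite -{2}(fK x); apply: f_le; rewrite fK. Qed.

(** Induction along a chain of steps ending at y: each step a, b is either mapped by [f] to a step
    or has b = f a. *)
Lemma bruhat_lift_down x y : x <=B y -> (len (f y) < len y)%N -> f x <=B y.
Proof.
move=> xy ydown; apply: (@clos_refl_trans_ind_right _ _ (fun a => f a <=B y) _ _ _ _ xy).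
  exact: f_ge.
move=> a b ab IH ley.
have [<-//|fab] := f_step ab.
exact: bruhat_trans (rt_step _ _ _ _ fab) IH.
Qed.

Lemma bruhat_lift_up x y : x <=B y -> (len x < len (f x))%N -> x <=B f y.
Proof.
move=> xy xup; apply: (@clos_refl_trans_ind_left _ _ _ (fun b => x <=B f b) _ _ _ xy).
  exact: f_le.
move=> a b ley IH ab.
have [->|fab] := f_step ab; first by rewrite fK.
exact: bruhat_trans IH (rt_step _ _ _ _ fab).
Qed.

Lemma bruhat_lift_upup x y : x <=B y -> (len y < len (f y))%N -> f x <=B f y.
Proof.
move=> xy yup; apply: bruhat_lift_down; last by rewrite fK.
exact: bruhat_trans xy (f_le yup).
Qed.

Lemma bruhat_lift_downdown x y : x <=B y -> (len (f x) < len x)%N -> f x <=B f y.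
Proof.
move=> xy xdown; apply: bruhat_lift_up; last by rewrite fK.
exact: bruhat_trans (f_ge xdown) xy.
Qed.

Lemma bruhat_lifting :
  lifting (fun=> True) (bruhat s) (fun x => (len x)%:Z%R) f.
Proof.
split=> //.
- by move=> p _; have := f_len p; lia.
- by move=> p _ lt; apply: f_le; lia.
- move=> p q pq pup qdown.
  by split; [apply: bruhat_lift_down|apply: bruhat_lift_up] => //; lia.
- by move=> p q pq _ qup; apply: bruhat_lift_upup => //; lia.
- by move=> p q pq pdown _; apply: bruhat_lift_downdown => //; lia.
Qed.

End Lift.

Section RightLift.
Variable i : I.
Let f x := x * s i.
Let fK : involutive f. Proof. by move=> x; apply: simpleK. Qed.

Lemma liftr_down x y : x <=B y -> (len (y * s i) < len y)%N -> x * s i <=B y.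
Proof.
exact: (@bruhat_lift_down f fK (fun x => @bruhat_simple x i) (@bruhat_step_simple i)).
Qed.

Lemma liftr_up x y : x <=B y -> (len x < len (x * s i))%N -> x <=B y * s i.
Proof.
exact: (@bruhat_lift_up f fK (fun x => @bruhat_simple x i) (@bruhat_step_simple i)).
Qed.

Lemma liftr_upup x y : x <=B y -> (len y < len (y * s i))%N -> x * s i <=B y * s i.
Proof.
exact: (@bruhat_lift_upup f fK (fun x => @bruhat_simple x i) (@bruhat_step_simple i)).
Qed.

Lemma liftr_downdown x y : x <=B y -> (len (x * s i) < len x)%N ->
  x * s i <=B y * s i.
Proof.
exact: (@bruhat_lift_downdown f fK (fun x => @bruhat_simple x i) (@bruhat_step_simple i)).
Qed.

End RightLift.

Section LeftLift.
Variable i : I.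
Let f x := s i * x.
Let fK : involutive f. Proof. by move=> x; apply: simpleKl. Qed.

Lemma liftl_down x y : x <=B y -> (len (s i * y) < len y)%N -> s i * x <=B y.
Proof.
exact: (@bruhat_lift_down f fK (fun x => @bruhat_simplel x i) (@bruhat_step_simplel i)).
Qed.

Lemma liftl_up x y : x <=B y -> (len x < len (s i * x))%N -> x <=B s i * y.
Proof.
exact: (@bruhat_lift_up f fK (fun x => @bruhat_simplel x i) (@bruhat_step_simplel i)).
Qed.

Lemma liftl_upup x y : x <=B y -> (len y < len (s i * y))%N -> s i * x <=B s i * y.
Proof.
exact: (@bruhat_lift_upup f fK (fun x => @bruhat_simplel x i) (@bruhat_step_simplel i)).
Qed.

Lemma liftl_downdown x y : x <=B y -> (len (s i * x) < len x)%N ->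
  s i * x <=B s i * y.
Proof.
exact: (@bruhat_lift_downdown f fK (fun x => @bruhat_simplel x i) (@bruhat_step_simplel i)).
Qed.

End LeftLift.

(** Induction on the length of y, lifting along a right descent of y. *)
Lemma bruhat_diamond x y : x <=B y -> len y = (len x).+2 ->
  diamond (bruhat s) (fun z => (len z)%:Z%R) x y.
Proof.
have [n] := ubnP (len y); elim: n x y => // n IH x y lt xy lxy.
have [|i /eta_length ydown] := @right_descent y.
  by move=> y1; rewrite y1 length1 in lxy.
apply: (@diamond_lift _ (fun=> True) (bruhat s) (fun z => (len z)%:Z%R) _ _
          (fun x => x * s i)) => //.
- by move=> p q /bruhat_eq E [/E].
- apply: bruhat_lifting.
  + by move=> z; apply: simpleK.
  + by move=> z; apply: length_simpleP.
  + by move=> z; apply: bruhat_simple.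
  + by move=> a b; apply: bruhat_step_simple.
- by lia.
- have := length_simpleP x i; have := length_simpleP y i => ly lx xdown.
  by apply: IH; [lia|apply: liftr_downdown => //; lia|lia].
Qed.

(** * Parabolic cosets *)

Section Parabolic.
Variable J : set I.
Local Notation WJ := (parabolic s J).

Lemma parabolic_word (r : seq I) : wordof J r -> WJ (word r).
Proof.
elim: r => [|i r IH] /=; first by rewrite word_nil => _; apply: parabolic1.
case/andP => /asboolP Ji /IH Wr; rewrite word_cons.
by apply: parabolicM => //; apply: parabolic_simple.
Qed.

Lemma parabolic_reduced z : WJ z ->
  exists r : seq I, [/\ wordof J r, z = word r & size r = len z].
Proof.
case/gen_word => r + ->; elim/last_ind: r => [|r i IH].
  by move=> _; exists [::]; rewrite word_nil length1.
rewrite all_rcons => /andP[Ji /IH[q [Jq qE sq]]].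
rewrite -cats1 word_cat word1 /= qE.
case: (boolP (eta (word q) (s i))) => [e|ne].
  have [r1 [k [r2 [rE E]]]] := eta_exchange e.
  exists (r1 ++ r2); split=> //.
    by move: Jq; rewrite rE !all_cat /= => /and3P[-> _ ->].
  rewrite length_simple e -qE -sq rE !size_cat /=; lia.
exists (q ++ [:: i]); split.
- by rewrite all_cat Jq /= Ji.
- by rewrite word_cat word1.
- by rewrite length_simple (negPf ne) size_cat /= -qE -sq; lia.
Qed.

Lemma parabolic_ind (P : W -> Prop) : P 1 ->
  (forall z j, WJ z -> J j -> (len z < len (z * s j))%N -> P z -> P (z * s j)) ->
  forall z, WJ z -> P z.
Proof.
move=> P1 PS z /parabolic_reduced[r []].
elim/last_ind: r z => [|r i IH] z; first by rewrite word_nil => _ ->.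
rewrite all_rcons -cats1 word_cat word1 size_cat /= => /andP[/asboolP Ji Jr] zE sz.
have lr := length_word r; have := length_simpleP (word r) i.
rewrite -zE => lz; rewrite zE; apply: PS => //; first exact: parabolic_word.
  rewrite -zE. lia.
by apply: IH => //; lia.
Qed.

(** Build z by an increasing chain of letters. A letter s_j raising z but lowering w z would make z
    s_j z^-1, a reflection in W_J, an inversion of w, against minimality. *)
Lemma min_reps_length w z : min_reps s J w -> WJ z ->
  len (w * z) = (len w + len z)%N.
Proof.
move=> mw; move: z; apply: parabolic_ind => [|z j Wz Jj zup IH].
  by rewrite mulg1 length1 addn0.
have rt : reflection s (s j ^ z^-1) by apply/reflectionJ/reflection_simple.
have e : eta (w * z) (s j) = false.
  rewrite etaM (eta_up zup) /= etaE //; apply/negbTE; rewrite -leqNgt.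
  apply: mw; rewrite conjgE invgK; apply: parabolicM => //.
  by apply: parabolicM; [apply: parabolic_simple|apply: parabolicV].
have := length_simpleP z j.
by rewrite mulA (length_simple (w * z)) e IH; lia.
Qed.

(** Dual to [min_reps_length]: every reflection lying in W_J is an inversion of a maximal x, so each
    letter raising u lowers x u. *)
Lemma max_reps_length x u : max_reps s J x -> WJ u ->
  (len (x * u) + len u)%N = len x.
Proof.
move=> mx; move: u; apply: parabolic_ind => [|u j Wu Jj uup IH].
  by rewrite mulg1 length1 addn0.
have rt : reflection s (s j ^ u^-1) by apply/reflectionJ/reflection_simple.
have Wt : WJ (s j ^ u^-1).
  rewrite conjgE invgK; apply: parabolicM => //.
  by apply: parabolicM; [apply: parabolic_simple|apply: parabolicV].
have xt : eta x (s j ^ u^-1).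
  case: (boolP (eta x _)) => // /negPf /(length_reflection rt).
  by rewrite ltnNge mx.
have e : eta (x * u) (s j) by rewrite etaM (eta_up uup) xt.
have := eta_simple_gt0 e; have := length_simpleP u j.
by rewrite mulA (length_simple (x * u)) e; lia.
Qed.

Lemma min_rep_exists v : exists w z, [/\ min_reps s J w, WJ z & v = w * z].
Proof.
pose P n := `[< exists2 z, WJ z & len (v * z) = n >].
have exP : exists n, P n.
  by exists (len (v * 1)); apply/asboolP; exists 1 => //; apply: parabolic1.
case: (ex_minnP exP) => n /asboolP[z Wz zn] min_n.
exists (v * z), z^-1; split; last by rewrite mulgK.
  move=> y Wy; rewrite zn; apply: min_n; apply/asboolP.
  by exists (z * y); [apply: parabolicM|rewrite mulA].
exact: parabolicV.
Qed.

Lemma max_rep_exists v : finite_set WJ ->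
  exists2 u, WJ u & max_reps s J (v * u).
Proof.
move=> /finite_seqP[r rE].
pose P n := `[< exists2 z, WJ z & len (v * z) = n >].
have exP : exists n, P n.
  by exists (len (v * 1)); apply/asboolP; exists 1 => //; apply: parabolic1.
(* Finiteness of W_J bounds the lengths in the coset. *)
have ubP n : P n -> (n <= \max_(z <- r) len (v * z))%N.
  move=> /asboolP[z Wz <-].
  have zr : z \in r by move: Wz; rewrite rE.
  exact: (@leq_bigmax_seq _ _ xpredT (fun z => len (v * z)) z zr).
case: (ex_maxnP exP ubP) => n /asboolP[z Wz zn] max_n.
exists z => // y Wy; rewrite zn; apply: max_n; apply/asboolP.
by exists (z * y); [apply: parabolicM|rewrite mulA].
Qed.

(** Otherwise w = w0 z with w0 minimal and z nontrivial, and the last letter of a reduced word of z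
    in J is a right descent of w. *)
Lemma min_reps_simple w : (forall j, J j -> (len w < len (w * s j))%N) ->
  min_reps s J w.
Proof.
move=> wup; have [w0 [z [mw Wz wE]]] := min_rep_exists w.
have [r [Jr zE sz]] := parabolic_reduced Wz.
case: (lastP r) Jr zE sz => [|r' j].
  by rewrite word_nil => _ z1 _; rewrite wE z1 mulg1.
rewrite all_rcons -cats1 word_cat word1 size_cat /= => /andP[/asboolP Jj Jr'] zE sz.
have zj : z * s j = word r' by rewrite zE simpleK.
have := wup j Jj; rewrite wE -mulA zj !min_reps_length //.
  by have := length_word r'; lia.
exact: parabolic_word.
Qed.

Lemma min_reps_up w j : min_reps s J w -> J j -> (len w < len (w * s j))%N.
Proof.
move=> mw Jj; have := mw _ (parabolic_simple Jj).
by have := length_simpleP w j; lia.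
Qed.

(** By the cocycle rule, s_j can become an inversion of s_i w only if w s_j w^-1 = s_i. This is the
    dichotomy on which [act] rests. *)
Lemma min_reps_mull w i : min_reps s J w -> (forall j, J j -> s i * w <> w * s j) ->
  min_reps s J (s i * w).
Proof.
move=> mw niw; apply: min_reps_simple => j Jj.
apply: length_reflection; first exact: reflection_simple.
rewrite etaM (eta_up (min_reps_up mw Jj)) eta_simple.
by apply/eqP => E; apply: (niw j Jj); rewrite -E -conjgCV.
Qed.

(** * The order on pairs *)

(** The witness z is the factor u_1 of u in the order on cells, and u_2 = z^-1 u. *)
Definition linked v w v' w' := exists z,
  [/\ WJ z, len (v * z) = (len v + len z)%N, v' <=B v * z & w * z <=B w'].

Section Linked.
Variables (i : I) (v w v' w' : W).
Hypotheses (mw : min_reps s J w) (mw' : min_reps s J w').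
Hypothesis vw : linked v w v' w'.

Lemma linked_updown_mull_mull :
  min_reps s J (s i * w) -> (len w < len (s i * w))%N ->
  (len (s i * w') < len w')%N ->
  linked v (s i * w) v' w' /\ linked v w v' (s i * w').
Proof.
move=> msw wup w'down; have [z [Wz vz v'z wz]] := vw.
have up : (len (w * z) < len (s i * (w * z)))%N.
  by rewrite mulA (min_reps_length mw) // (min_reps_length msw) //; lia.
split; exists z; split=> //; first by rewrite -mulA; apply: liftl_down.
exact: liftl_up.
Qed.

Section Conj.
Variable j : I.
Hypotheses (Jj : J j) (swj : s i * w = w * s j) (vj : (len (v * s j) < len v)%N).

(** The element s_j z replaces z when v is replaced by v s_j. As v s_j is shorter than v, additivity
    of the length of v z forces s_j z to be longer than z. *)
Let lift_witness z : WJ z -> len (v * z) = (len v + len z)%N ->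
  [/\ WJ (s j * z), v * s j * (s j * z) = v * z, len (s j * z) = (len z).+1,
      len (v * s j * (s j * z)) = (len (v * s j) + len (s j * z))%N &
      s i * (w * z) = w * (s j * z)].
Proof.
move=> Wz vz; have E : v * s j * (s j * z) = v * z by rewrite mulA simpleK.
have := lengthM (v * s j) (s j * z); rewrite E vz.
have := length_simplelP z j; have := length_simpleP v j => lv lz le.
split=> //; try lia; last by rewrite !mulA swj.
by apply: parabolicM => //; apply: parabolic_simple.
Qed.

Lemma linked_updown_conj_mull : (len (s i * w') < len w')%N ->
  linked (v * s j) w v' w' /\ linked v w v' (s i * w').
Proof.
move=> w'down; have [z [Wz vz v'z wz]] := vw.
have [Wy Ey ly ry sE] := lift_witness Wz vz.
split; first exists (s j * z).
  by split=> //; rewrite ?Ey // -sE; apply: liftl_down.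
exists z; split=> //; apply: liftl_up => //.
by rewrite sE !(min_reps_length mw) //; lia.
Qed.

(** Put y = s_j z, so that w y <= w' s_k. For the first link, take y as witness if s_k raises y, and
    y s_k otherwise. For the second, take z if s_k lowers v z, and z s_k otherwise. *)
Lemma linked_updown_conj_conj k : J k -> s i * w' = w' * s k ->
  (len v' < len (v' * s k))%N ->
  linked (v * s j) w v' w' /\ linked v w (v' * s k) w'.
Proof.
move=> Jk swk v'k; have [z [Wz vz v'z wz]] := vw.
have [Wy Ey ly ry sE] := lift_witness Wz vz.
have w'k := min_reps_up mw' Jk.
have le_sw' : w * (s j * z) <=B w' * s k.
  by rewrite -sE -swk; apply: liftl_upup; rewrite // swk.
have Wyk : WJ (s j * z * s k).
  by apply: parabolicM => //; apply: parabolic_simple.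
have Wzk : WJ (z * s k) by apply: parabolicM => //; apply: parabolic_simple.
have le_w' : (len (s j * z) < len (s j * z * s k))%N -> w * (s j * z) <=B w'.
  move=> yk; rewrite -(simpleK k w'); apply: liftr_up => //.
  by rewrite -mulA !(min_reps_length mw) //; lia.
have lyk := length_simpleP (s j * z) k.
have lvzk := length_simpleP (v * z) k.
have := lengthM (v * s j) (s j * z * s k); rewrite mulA Ey => lvyk.
split.
  case: (ltnP (len (s j * z)) (len (s j * z * s k))) => yk.
    by exists (s j * z); split=> //; rewrite ?Ey //; apply: le_w'.
  exists (s j * z * s k); rewrite mulA Ey; split=> //; first by lia.
    exact: liftr_up.
  rewrite mulA -(simpleK k w'); apply: liftr_downdown => //.
  by rewrite -mulA !(min_reps_length mw) //; lia.
case: (ltnP (len (v * z * s k)) (len (v * z))) => vzk.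
  by exists z; split=> //; apply: liftr_down.
have := lengthM v (z * s k); rewrite mulA => lvzk'.
have lzk := length_simpleP z k; have := length_simpleP v j => lv.
exists (z * s k); rewrite !mulA; split=> //; first by lia.
  by apply: liftr_upup => //; lia.
(* Additivity forces s_k to raise y, hence w y <= w' and w y s_k <= w' s_k = s_i w'. Multiplying by
   s_i on the left, a descent of w y s_k, gives w z s_k <= w'. *)
have E : w * z * s k = s i * (w * (s j * z) * s k).
  by rewrite -sE !mulA simple_sq // mul1g.
rewrite E -[X in _ <=B X](simpleKl i) swk; apply: liftl_downdown.
  by apply: liftr_upup => //; apply: le_w'; lia.
by rewrite -E -(mulA w z) -(mulA w (s j * z)) !(min_reps_length mw) //; lia.
Qed.

End Conj.

(** The same case splits as in [linked_updown_conj_conj], with s_i w z in the role of w s_j z, so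
    that z itself serves in place of s_j z. *)
Lemma linked_updown_mull_conj k : min_reps s J (s i * w) ->
  (len w < len (s i * w))%N -> J k -> s i * w' = w' * s k ->
  (len v' < len (v' * s k))%N ->
  linked v (s i * w) v' w' /\ linked v w (v' * s k) w'.
Proof.
move=> msw wup Jk swk v'k; have [z [Wz vz v'z wz]] := vw.
have w'k := min_reps_up mw' Jk.
have le_sw' : s i * w * z <=B w' * s k.
  by rewrite -swk -mulA; apply: liftl_upup; rewrite // swk.
have Wzk : WJ (z * s k) by apply: parabolicM => //; apply: parabolic_simple.
have le_w' : (len z < len (z * s k))%N -> s i * w * z <=B w'.
  move=> zk; rewrite -(simpleK k w'); apply: liftr_up => //.
  by rewrite -[_ * s k]mulA !(min_reps_length msw) //; lia.
have lzk := length_simpleP z k.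
have lvzk := length_simpleP (v * z) k.
have := lengthM v (z * s k); rewrite mulA => lvzk'.
split.
  case: (ltnP (len z) (len (z * s k))) => zk.
    by exists z; split=> //; apply: le_w'.
  exists (z * s k); rewrite mulA; split=> //; first by lia.
    exact: liftr_up.
  rewrite mulA -(simpleK k w'); apply: liftr_downdown => //.
  by rewrite -[_ * s k]mulA !(min_reps_length msw) //; lia.
case: (ltnP (len (v * z * s k)) (len (v * z))) => vzk.
  by exists z; split=> //; apply: liftr_down.
exists (z * s k); rewrite !mulA; split=> //; first by lia.
  by apply: liftr_upup => //; lia.
have E : w * z * s k = s i * (s i * w * z * s k) by rewrite !mulA simple_sq // mul1g.
rewrite E -[X in _ <=B X](simpleKl i) swk; apply: liftl_downdown.
  by apply: liftr_upup => //; apply: le_w'; lia.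
rewrite -E -(mulA w z) -(mulA (s i * w)).
by rewrite (min_reps_length mw) // (min_reps_length msw) //; lia.
Qed.

End Linked.

Lemma linked1 v w v' : min_reps s J w -> linked v w v' 1 <-> w = 1 /\ v' <=B v.
Proof.
move=> mw; split=> [[z [Wz _ v'z /bruhat_length]]|[-> le]].
  rewrite length1 (min_reps_length mw) // leqn0 addn_eq0.
  move=> /andP[/eqP/length_eq0 w1 /eqP/length_eq0 z1].
  by rewrite z1 mulg1 in v'z.
exists 1; rewrite !mulg1 length1 addn0; split=> //; first exact: parabolic1.
exact: bruhat_refl.
Qed.

Lemma linked_id v w v' w' : v' <=B v -> w <=B w' -> linked v w v' w'.
Proof.
move=> lev lew; exists 1; rewrite !mulg1 length1 addn0.
by split=> //; apply: parabolic1.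
Qed.

Lemma linked_trans_bruhat v w v1 w1 v' w' : linked v w v1 w1 ->
  v' <=B v1 -> w1 <=B w' -> linked v w v' w'.
Proof.
move=> [z [Wz vz v1z wz]] lev lew; exists z; split=> //.
  exact: bruhat_trans v1z.
exact: bruhat_trans lew.
Qed.

Lemma linked_down_mull i v w v' w' :
  min_reps s J w -> min_reps s J (s i * w) -> (len (s i * w) < len w)%N ->
  linked v w v' w' -> linked v (s i * w) v' w'.
Proof.
move=> mw msw wdown [z [Wz vz v'z wz]]; exists z; split=> //.
apply: bruhat_trans wz; have E : w * z = s i * (s i * w * z).
  by rewrite !mulA simple_sq // mul1g.
rewrite [X in _ <=B X]E; apply: bruhat_simplel.
by rewrite -E (min_reps_length mw) // (min_reps_length msw) //; lia.
Qed.

(** Read z letter by letter, keeping a letter in z' when it raises b z' and skipping it otherwise.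
    This repairs the witness of a link whose v is replaced by a larger element. *)
Lemma bruhat_mul_parabolic a b w z : min_reps s J w -> WJ z -> a <=B b ->
  len (a * z) = (len a + len z)%N ->
  exists z', [/\ WJ z', len (b * z') = (len b + len z')%N, a * z <=B b * z' &
    w * z' <=B w * z].
Proof.
move=> mw + ab; move: z.
apply: parabolic_ind => [_|z j Wz Jj zup IH].
  exists 1; rewrite !mulg1 length1 addn0; split=> //; first exact: parabolic1.
  exact: bruhat_refl.
rewrite mulA => azj; have lz := length_simpleP z j; have laz := length_simpleP (a * z) j.
have := lengthM a z => laz'.
have [|z' [Wz' bz' le lew]] := IH; first by lia.
have Wzj : WJ (z * s j) by apply: parabolicM => //; apply: parabolic_simple.
have Wz'j : WJ (z' * s j) by apply: parabolicM => //; apply: parabolic_simple.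
have wzj : (len (w * z) < len (w * z * s j))%N.
  by rewrite -(mulA w) !(min_reps_length mw) //; lia.
have lbz := length_simpleP (b * z') j.
case: (ltnP (len (b * z')) (len (b * z' * s j))) => bz'j.
  have := lengthM b (z' * s j); have := length_simpleP z' j; rewrite mulA => lz' lbz'.
  exists (z' * s j); split=> //; rewrite ?mulA; first by lia.
    exact: liftr_upup.
  exact: liftr_upup.
exists z'; split=> //; first by apply: liftr_down => //; lia.
rewrite mulA; apply: bruhat_trans lew _; exact: bruhat_simple.
Qed.

Lemma linked_down_conj i j v w v' w' : min_reps s J w -> J j ->
  s i * w = w * s j -> (len v < len (v * s j))%N ->
  linked v w v' w' -> linked (v * s j) w v' w'.
Proof.
move=> mw Jj swj vup [z [Wz vz v'z wz]].
have [z' [Wz' vz' le lew]] := bruhat_mul_parabolic mw Wz (bruhat_simple vup) vz.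
exists z'; split=> //; first exact: bruhat_trans le.
exact: bruhat_trans wz.
Qed.

(** * The action of simple reflections on pairs *)

Implicit Types p q r : W * W.

Definition Pdom p := min_reps s J p.2.

Definition Ple p q := [/\ Pdom p, Pdom q & linked p.1 p.2 q.1 q.2].

Definition Prk p : int := ((len p.2)%:Z - (len p.1)%:Z)%R.

(** In the absorbing case [s i ^ p.2] is s_j itself, so no index j has to be chosen; [actP] recovers
    one. *)
Definition act i p : W * W :=
  if `[< (s @` J) (s i ^ p.2) >] then (p.1 * s i ^ p.2, p.2) else (p.1, s i * p.2).

Variant act_spec i p : W * W -> Prop :=
| ActConj j of J j & s i * p.2 = p.2 * s j : act_spec i p (p.1 * s j, p.2)
| ActMull of (forall j, J j -> s i * p.2 <> p.2 * s j) :
    act_spec i p (p.1, s i * p.2).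

Lemma actP i p : act_spec i p (act i p).
Proof.
rewrite /act; case: asboolP => [[j Jj sj]|nJ].
  by rewrite -sj; apply: ActConj => //; rewrite sj -conjgC.
apply: ActMull => j Jj E; apply: nJ; exists j => //.
by rewrite conjgE E mulKg.
Qed.

(** Conjugating s_i by s_i w or by w gives the same element, so both applications take the same
    branch. *)
Lemma actK i p : act i (act i p) = p.
Proof.
have sJ : s i ^ s i = s i by rewrite conjgE mulKg.
case: p => v w.
have actE x y : act i (x, y) =
  if `[< (s @` J) (s i ^ y) >] then (x * s i ^ y, y) else (x, s i * y) by [].
rewrite (actE v); case H: `[< _ >]; rewrite actE ?conjgM ?sJ H.
  by rewrite reflectionK //; apply/reflectionJ/reflection_simple.
by rewrite simpleKl.
Qed.

Lemma act_dom i p : Pdom p -> Pdom (act i p).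
Proof. by move=> Dp; case: actP => // ni; apply: min_reps_mull. Qed.

Lemma act_rank i p : (Prk (act i p) = Prk p + 1 \/ Prk (act i p) = Prk p - 1)%R.
Proof.
rewrite /Prk; case: actP => [j Jj _|_] /=.
  by have := length_simpleP p.1 j; lia.
by have := length_simplelP p.2 i; lia.
Qed.

Lemma act_le i p : Pdom p -> (Prk p < Prk (act i p))%R -> Ple p (act i p).
Proof.
move=> Dp; have := act_dom i Dp; rewrite /Prk.
case: actP => [j Jj sj|ni] /= D' up; split=> //=; apply: linked_id.
- by rewrite -{2}(simpleK j p.1); apply: bruhat_simple; rewrite simpleK; lia.
- exact: bruhat_refl.
- exact: bruhat_refl.
- by apply: bruhat_simplel; lia.
Qed.

(** One case for each way s_i acts on p and on q. The rank counts the first component negatively, so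
    absorbing s_j moves a pair up when s_j is a right descent of that component. *)
Lemma act_updown i p q : Ple p q -> (Prk p < Prk (act i p))%R ->
  (Prk (act i q) < Prk q)%R -> Ple (act i p) q /\ Ple p (act i q).
Proof.
move=> [Dp Dq lpq]; have := act_dom i Dp; have := act_dom i Dq; rewrite /Prk /Pdom.
case: (actP i p) => [j Jj sj|ni]; case: (actP i q) => [k Jk sk|nk] /= Dq' Dp' up down.
- have vj : (len (p.1 * s j) < len p.1)%N by lia.
  have v'k : (len q.1 < len (q.1 * s k))%N by lia.
  by have [] := linked_updown_conj_conj Dp Dq lpq Jj sj vj Jk sk v'k.
- have vj : (len (p.1 * s j) < len p.1)%N by lia.
  have w'i : (len (s i * q.2) < len q.2)%N by lia.
  by have [] := linked_updown_conj_mull Dp lpq Jj sj vj w'i.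
- have wi : (len p.2 < len (s i * p.2))%N by lia.
  have v'k : (len q.1 < len (q.1 * s k))%N by lia.
  by have [] := linked_updown_mull_conj Dp Dq lpq Dp' wi Jk sk v'k.
- have wi : (len p.2 < len (s i * p.2))%N by lia.
  have w'i : (len (s i * q.2) < len q.2)%N by lia.
  by have [] := linked_updown_mull_mull Dp lpq Dp' wi w'i.
Qed.

(** Transitivity along an upward move of q. With [act_updown] it yields the up-up lifting;
    [act_down] serves the down-down one. *)
Lemma act_trans i p q : Ple p q -> (Prk q < Prk (act i q))%R -> Ple p (act i q).
Proof.
move=> [Dp Dq lpq] up; have [_ Dq' _] := act_le Dq up.
split=> //; apply: linked_trans_bruhat lpq _ _; move: up; rewrite /Prk.
  case: actP => [k Jk sk|nk] /= up; last exact: bruhat_refl.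
  by rewrite -{2}(simpleK k q.1); apply: bruhat_simple; rewrite simpleK; lia.
case: actP => [k Jk sk|nk] /= up; first exact: bruhat_refl.
by apply: bruhat_simplel; lia.
Qed.

Lemma act_down i p q : Ple p q -> (Prk (act i p) < Prk p)%R -> Ple (act i p) q.
Proof.
move=> [Dp Dq lpq] down; have Dp' := act_dom i Dp; split=> //.
move: down Dp'; rewrite /Prk /Pdom; case: actP => [j Jj sj|nj] /= down Dp'.
  by apply: (linked_down_conj Dp Jj sj) => //; lia.
by apply: linked_down_mull => //; lia.
Qed.

Lemma act_lifting i : lifting Pdom Ple Prk (act i).
Proof.
split.
- exact: act_dom.
- by move=> p _; apply: actK.
- by move=> p _; apply: act_rank.
- exact: act_le.
- exact: act_updown.
- move=> p q pq pup qup.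
  by have [] := act_updown (act_trans pq qup) pup; rewrite ?actK.
- move=> p q pq pdown qdown.
  by have [] := act_updown (act_down pq pdown) _ qdown; rewrite ?actK.
Qed.

(** Equal ranks force v' = v z and w' = w z. Then w and w' are minimal in the same coset, so z =
    1. *)
Lemma Ple_eq p q : Ple p q -> Prk p = Prk q -> p = q.
Proof.
case: p q => [v w] [v' w']; rewrite /Ple /Pdom /Prk /=.
move=> [mw mw' [z [Wz vz v'z wz]]] E.
have lv := bruhat_length v'z; have lw := bruhat_length wz.
have lwz := min_reps_length mw Wz.
have v'E : v' = v * z by apply: bruhat_eq => //; lia.
have w'E : w * z = w' by apply: bruhat_eq => //; lia.
have := min_reps_length mw' (parabolicV Wz); rewrite -w'E mulgK lengthV => lw'.
have z1 : z = 1 by apply: length_eq0; lia.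
by rewrite v'E z1 !mulg1.
Qed.

Lemma Ple_diamond p q : Ple p q -> (Prk q = Prk p + 2)%R -> diamond Ple Prk p q.
Proof.
have [n] := ubnP (len q.2); elim: n p q => // n IH p q lt pq rkpq.
case: (pselect (q.2 = 1)) => [q1|q1].
  case: p q pq q1 rkpq {lt} => v w [v' w']; rewrite {1}/Ple /Pdom /= => -[mw mw' + w'1].
  rewrite {w'}w'1 in mw' *; rewrite (linked1 _ _ mw) /Prk /= => -[w1 le] rk.
  rewrite {w}w1 in mw rk *.
  (* When w' = 1, every pair in the interval has second component 1, and the order on first
     components is the reversed Bruhat order. *)
  have [|a [b [ab abP]]] := bruhat_diamond le; first by lia.
  exists (a, 1), (b, 1); split=> [[] //|[x y]].
  have -> : (x, y) = (a, 1) \/ (x, y) = (b, 1) <-> y = 1 /\ (x = a \/ x = b).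
    by split=> [[[-> ->]|[-> ->]]|[-> [->|->]]]; tauto.
  rewrite -abP; split.
    move=> [[_ my l1] [_ _ l2] rkx]; move: l2; rewrite /= linked1 // => -[y1 l2].
    rewrite {y}y1 /= in my l1 rkx *; move: l1; rewrite linked1 // => -[_ l1].
    by split=> //; split=> //; move: rkx; rewrite /Prk /=; lia.
  move=> [-> [l1 l2 rkx]]; split; last by rewrite /Prk /=; lia.
    by split=> //=; apply/linked1.
  by split=> //=; apply/linked1.
have [|i /eta_length] := @right_descent q.2^-1.
  by move=> E; apply: q1; rewrite -(invgK q.2) E invg1.
rewrite -length_simplelE lengthV => down.
(* A left descent of w' cannot be absorbed, since w' s_j is longer than w' for j in J. So the action
   shortens w' and the induction applies. *)
have actq : act i q = (q.1, s i * q.2).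
  case: actP => // j Jj E; have [_ Dq _] := pq.
  by have := min_reps_up Dq Jj; rewrite -E; lia.
apply: (@diamond_lift _ Pdom Ple Prk _ _ (act i)) => //.
- by move=> x y [].
- exact: Ple_eq.
- exact: act_lifting.
- by rewrite actq /Prk /=; lia.
move=> pdown; have qdown : (Prk (act i q) < Prk q)%R by rewrite actq /Prk /=; lia.
apply: IH.
- by rewrite actq /=; lia.
- exact: lift_downdown (act_lifting i) _ _ pq pdown qdown.
- by have := act_rank i p; have := act_rank i q; lia.
Qed.

(** * From cells to pairs *)

(** Each letter of z raises both sides, so lifting can be used in either direction. *)
Lemma bruhat_mulr a b z : WJ z -> len (a * z) = (len a + len z)%N ->
  len (b * z) = (len b + len z)%N -> a <=B b <-> a * z <=B b * z.
Proof.
move: z; apply: parabolic_ind => [|z j Wz Jj zup IH]; first by rewrite !mulg1.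
rewrite !mulA => laz lbz.
have := lengthM a z; have := lengthM b z.
have lza := length_simpleP (a * z) j; have lzb := length_simpleP (b * z) j.
have lz := length_simpleP z j => lb la.
rewrite IH; [|lia..]; split=> le; first by apply: liftr_upup => //; lia.
rewrite -(simpleK j (a * z)) -(simpleK j (b * z)).
by apply: liftr_downdown; rewrite ?simpleK //; lia.
Qed.

Definition cell_pair (c : triples s J) : W * W :=
  let: (x, u, w) := val c in (x * u^-1, w).

Lemma cell_pairP c : exists x u w,
  [/\ val c = (x, u, w), triples s J (x, u, w), cell_pair c = (x * u^-1, w)
    & len x = (len (x * u^-1)%g + len u)%N].
Proof.
have := set_valP c; rewrite /cell_pair; case: (val c) => [[x u] w] H.
exists x, u, w; split=> //; have [mx Wu _ _] := H.
by rewrite -(max_reps_length mx (parabolicV Wu)) lengthV.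
Qed.

Lemma cell_pair_dom c : Pdom (cell_pair c).
Proof. by have [x [u [w [_ [_ _ mw _] -> _]]]] := cell_pairP c. Qed.

Lemma cell_pair_le c : (cell_pair c).1 <=B (cell_pair c).2.
Proof.
have [x [u [w [_ [mx Wu mw le] -> lx]]]] := cell_pairP c => /=.
by apply/(bruhat_mulr Wu); rewrite ?mulgVK // min_reps_length.
Qed.

(** Equal pairs give x and x' maximal in the same coset and differing by u^-1 u'; maximality of both
    forces u = u'. *)
Lemma cell_pair_inj : injective cell_pair.
Proof.
move=> c c'; have [x [u [w [E [mx Wu _ _] -> lx]]]] := cell_pairP c.
have [x' [u' [w' [E' [mx' Wu' _ _] -> lx']]]] := cell_pairP c'.
case=> xu ww'; apply: val_inj; rewrite E E' ww'.
have Wv : WJ (u^-1 * u') by apply: parabolicM => //; apply: parabolicV.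
have x'E : x' = x * (u^-1 * u') by rewrite mulA xu mulgVK.
have xE : x = x' * (u^-1 * u')^-1 by rewrite x'E mulgK.
have := max_reps_length mx Wv; have := max_reps_length mx' (parabolicV Wv).
rewrite -x'E -xE lengthV => l1 l2.
have v1 : u^-1 * u' = 1 by apply: length_eq0; lia.
by rewrite x'E v1 mulg1 -(mulVKg u u') v1 mulg1.
Qed.

(** Finiteness of W_J provides the maximal representative x = v u of the coset of v. *)
Lemma cell_pair_surj v w : finite_set WJ -> min_reps s J w -> v <=B w ->
  exists c, cell_pair c = (v, w).
Proof.
move=> fin mw vw; have [u Wu mx] := max_rep_exists v fin.
have lvu := max_reps_length mx (parabolicV Wu).
rewrite mulgK lengthV in lvu.
have T : triples s J (v * u, u, w).
  by split=> //; apply: (iffLR (bruhat_mulr Wu _ _)); rewrite ?(min_reps_length mw).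
by exists (SigSub (mem_set T)); rewrite /cell_pair /= mulgK.
Qed.

Lemma QleE c c' : Qle (Qcell c) (Qcell c') <-> Ple (cell_pair c) (cell_pair c').
Proof.
have Dc := cell_pair_dom c; have Dc' := cell_pair_dom c'.
have le := cell_pair_le c; move: Dc Dc' le.
have [x [u [w [E [mx Wu mw _] -> lx]]]] := cell_pairP c.
have [x' [u' [w' [E' [mx' Wu' mw' _] -> lx']]]] := cell_pairP c'.
rewrite /Qle E E' /Pdom /= => _ _ le; split.
  move=> [u1 [u2 [[W1 W2 uE lu] [le1 le2 le3]]]]; split=> //; exists u1 => /=.
  have xu : x * u^-1 * u1 = x * u2^-1 by rewrite -uE invgM -!mulA mulVg mulg1.
  have := max_reps_length mx (parabolicV W2); rewrite lengthV => lx2.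
  by rewrite xu; split=> //; lia.
move=> [_ _ [z [/= Wz lz v'z wz]]].
have Wz' : WJ (z^-1 * u) by apply: parabolicM => //; apply: parabolicV.
have xu : x * (z^-1 * u)^-1 = x * u^-1 * z by rewrite invgM invgK mulA.
have := max_reps_length mx (parabolicV Wz'); rewrite lengthV xu => lx2.
(* The middle inequality x u_2^-1 <= w u_1 reads v z <= w z, which follows from v <= w by
   multiplying by z. *)
exists z, (z^-1 * u); split; first by split; rewrite ?mulVKg //; lia.
rewrite xu; split=> //.
by apply: (iffLR (bruhat_mulr Wz _ _)); rewrite ?(min_reps_length mw).
Qed.

Lemma QrankE c : Qrank (Qcell c) = Prk (cell_pair c).
Proof.
have [x [u [w [E [_ Wu mw _] -> lx]]]] := cell_pairP c.
by rewrite /Qrank E /Prk /= (min_reps_length mw) //; lia.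
Qed.

(** * Intervals in the poset of cells *)

Lemma Ple_rank p q : Ple p q -> (Prk p <= Prk q)%R.
Proof.
move=> [mp _ [z [Wz vz /bruhat_length lv /bruhat_length lw]]].
by have := min_reps_length mp Wz; rewrite /Prk; lia.
Qed.

Lemma Ple_convex p q : Ple p q -> p.1 <=B p.2 -> q.1 <=B q.2.
Proof.
move=> [mp _ [z [Wz vz lv lw]]] le.
apply: bruhat_trans lv _; apply: bruhat_trans lw.
by apply: (iffLR (bruhat_mulr Wz _ _)); rewrite ?(min_reps_length mp).
Qed.

Lemma Q_thin_cells c d : finite_set WJ ->
  Qle (Qcell c) (Qcell d) -> (Qrank (Qcell d) = Qrank (Qcell c) + 2)%R ->
  exists a b : Q s J, a <> b /\
    forall r : Q s J, Qlt (Qcell c) r /\ Qlt r (Qcell d) <-> r = a \/ r = b.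
Proof.
move=> fin /QleE cd; rewrite !QrankE => rk.
have [a [b [ab abP]]] := Ple_diamond cd rk.
(* The middle pairs lie above the cell c, so they satisfy v <= w and come from cells. *)
have lift p : p = a \/ p = b -> exists e, cell_pair e = p.
  move=> /abP[cp _ _]; case: p cp => v w cp; apply: cell_pair_surj => //.
    by case: cp.
  exact: Ple_convex cp (cell_pair_le c).
have [[ca caE] [cb cbE]] := (lift a (or_introl erefl), lift b (or_intror erefl)).
exists (Qcell ca), (Qcell cb); split=> [[E]|r].
  by apply: ab; rewrite -caE -cbE E.
have -> : r = Qcell ca \/ r = Qcell cb <->
    exists2 e, r = Qcell e & cell_pair e = a \/ cell_pair e = b.
  split=> [[]->|[e -> []]]; [by exists ca; auto|by exists cb; auto| |].
    by rewrite -caE => /cell_pair_inj->; left.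
  by rewrite -cbE => /cell_pair_inj->; right.
split.
  case: r => [[[] //]|e [[/QleE ce cne] [/QleE ed edne]]]; exists e => //.
  apply/abP; split=> //.
  have := Ple_rank ce; have := Ple_rank ed => le1 le2.
  have n1 : Prk (cell_pair c) <> Prk (cell_pair e).
    by move/(Ple_eq ce)/cell_pair_inj => E; apply: cne; rewrite E.
  have n2 : Prk (cell_pair e) <> Prk (cell_pair d).
    by move/(Ple_eq ed)/cell_pair_inj => E; apply: edne; rewrite E.
  by lia.
move=> [e -> /abP[ce ed rke]]; split; split; try exact/QleE.
  by case=> E; rewrite E in rke; lia.
by case=> E; rewrite E in rke; lia.
Qed.

(** Let d correspond to (v, w), where w is one longer than v. A cell strictly below d has rank 0,
    hence is a pair (w1, w1) with v <= w1 z <= w. So w1 z is v or w, and w1 is the minimal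
    representative m of the coset of v, or w itself. *)
Lemma Q_thin_bottom d : finite_set WJ -> Qrank (Qcell d) = 1%R ->
  exists a b : Q s J, a <> b /\
    forall r : Q s J, Qlt (Qhat0 s J) r /\ Qlt r (Qcell d) <-> r = a \/ r = b.
Proof.
move=> fin; rewrite QrankE => rk.
have le := cell_pair_le d; have := cell_pair_dom d.
case E: (cell_pair d) rk le => [v w]; rewrite /Prk /Pdom /= => rk le mw.
have [m [y [mm Wy vE]]] := min_rep_exists v.
have lv := min_reps_length mm Wy; rewrite -vE in lv.
have [ca caE] := cell_pair_surj fin mw (bruhat_refl w).
have [cb cbE] := cell_pair_surj fin mm (bruhat_refl m).
exists (Qcell ca), (Qcell cb); split.
  case=> Eab; rewrite Eab cbE in caE; case: caE => mE.
  by rewrite mE in lv; lia.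
have rE (r : Q s J) : r = Qcell ca \/ r = Qcell cb <->
    exists2 e, r = Qcell e & cell_pair e = (w, w) \/ cell_pair e = (m, m).
  split=> [[]->|[e -> []]]; [by exists ca; auto|by exists cb; auto| |].
    by rewrite -caE => /cell_pair_inj->; left.
  by rewrite -cbE => /cell_pair_inj->; right.
move=> r; rewrite rE; split.
  case: r => [[[_ []] //]|e [_ [/QleE ed edne]]]; exists e => //.
  have ned : Prk (cell_pair e) <> Prk (cell_pair d).
    by move/(Ple_eq ed)/cell_pair_inj => E'; apply: edne; rewrite E'.
  have := Ple_rank ed; have := cell_pair_le e; move: ned ed.
  rewrite E; case: (cell_pair e) => [v1 w1]; rewrite /Prk /=.
  move=> ned [mw1 _ [z [/= Wz lz vz wz]]] le1 rke; rewrite /Pdom /= in mw1.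
  have lw1 := bruhat_length le1.
  (* The rank of e is nonnegative and less than 1, so both components have the same length. *)
  have v1w1 : v1 = w1 by apply: bruhat_eq => //; lia.
  rewrite {v1 le1 ned rke}v1w1 in lz vz lw1 *.
  have := bruhat_length vz; have := bruhat_length wz => l1 l2.
  case: (pselect (len (w1 * z) = len w)) => [lE|lE]; [left|right].
    have w1zE : w1 * z = w by apply: bruhat_eq.
    have := min_reps_length mw (parabolicV Wz); rewrite -w1zE mulgK lengthV => lw.
    have z1 : z = 1 by apply: length_eq0; lia.
    by rewrite z1 mulg1.
  have w1zE : v = w1 * z by apply: bruhat_eq => //; lia.
  have yE : w1 = m * (y * z^-1) by rewrite mulA -vE w1zE mulgK.
  have Wyz : WJ (y * z^-1) by apply: parabolicF.
  have mE : m = w1 * (y * z^-1)^-1 by rewrite yE mulgK.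
  have := min_reps_length mm Wyz; have := min_reps_length mw1 (parabolicV Wyz).
  rewrite -mE -yE lengthV => l3 l4.
  have yz1 : y * z^-1 = 1 by apply: length_eq0; lia.
  by rewrite yE yz1 mulg1.
move=> [e -> eE]; split; first by split.
have [mx my] : Pdom (cell_pair e) /\ linked (cell_pair e).1 (cell_pair e).2 v w.
  case: eE => -> /=; split=> //; first by apply: linked_id => //; apply: bruhat_refl.
  (* For (m, m) the witness is y, since m y = v. *)
  by exists y; rewrite -vE; split=> //; apply: bruhat_refl.
split; first by apply/QleE; rewrite E; split.
case=> Eed; rewrite Eed E in eE.
have vw : v = w by case: eE => [[->]|[-> ->]].
by rewrite vw in rk; lia.
Qed.

End Parabolic.

End CoxeterCombinatorics.

Theorem theorem1p1 (W : groupType) (I : Type) (s : I -> W) (J : set I) :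
  coxeter_system s ->
  finite_set (parabolic s J) ->
  forall p q : Q s J,
    Qlt p q ->
    (Qrank q - Qrank p = 2)%R ->
    [set r : Q s J | Qlt p r /\ Qlt r q] #= `I_2.
Proof.
move=> cox fin p q [pq _] rk.
suff [a [b [ab abP]]] : exists a b : Q s J, a <> b /\
    forall r : Q s J, Qlt p r /\ Qlt r q <-> r = a \/ r = b.
  have -> : [set r : Q s J | Qlt p r /\ Qlt r q] = [set a; b].
    by apply/seteqP; split=> r /abP.
  exact: card_pair.
case: p q pq rk => [|c] [|d] // pq rk.
  (* As the bottom has rank -1, the cell d has rank 1. *)
  have r0 : Qrank (Qhat0 s J) = (-1)%R by [].
  by apply: Q_thin_bottom => //; rewrite r0 in rk; lia.
by apply: Q_thin_cells => //; lia.
Qed.
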